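(* Let $q\ge 1$ be an integer, let $G$ be a simple connected graph with $n\ge 2$ nodes and $m$ edges, and let $S_q(G)$ be the $q$-subdivision graph of $G$ with node set $\hat V=V\cup V'$. Let $T_{ij}$ and $\hat T_{ij}$ denote hitting times in $G$ and in $S_q(G)$, respectively. Then: (i) if $i,j\in V$, then $\hat{T}_{ij}=4T_{ij}$; (ii) if $i\in V'$, $j\in V$, and $\hat{\Gamma}(i)=\{s,t\}$, then $$\hat{T}_{ij}=1+2(T_{sj}+T_{tj}),\qquad \hat{T}_{ji}=2mq-1+2(T_{js}+T_{jt})-(T_{ts}+T_{st});$$ (iii) if $i,j\in V'$ with $i\ne j$, $\hat{\Gamma}(i)=\{s,t\}$, $\hat{\Gamma}(j)=\{u,v\}$, then $$\hat{T}_{ij}=2mq+T_{su}+T_{tu}+T_{sv}+T_{tv}-(T_{uv}+T_{vu}).$$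
   Context: The $q$-subdivision graph $S_q(G)$ is obtained from $G$ by replacing each edge $uv$ with $q$ disjoint paths of length $2$: $ux_1v,\ldots,ux_qv$. $V=V(G)$ is the set of old nodes, $V'$ the set of $mq$ new nodes, and for $i\in V'$, $\hat\Gamma(i)$ is the set of neighbors of $i$ in $S_q(G)$, i.e. the two end nodes of the edge of $G$ that produced $i$. The (unbiased, discrete-time) random walk on a graph jumps at each step from the current node to a uniformly random neighbor. The hitting time $T_{ij}$ is the expected number of steps taken by the walk started at $i$ to first reach $j$, with $T_{ii}=0$. *)

(* Defs.v *)
From HB Require Import structures.
From mathcomp Require Import all_boot all_order all_algebra.
From mathcomp Require Import boolp classical_sets reals ereal topology.
From mathcomp Require Import normedtype sequences.

Set Implicit Arguments.
Unset Strict Implicit.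
Unset Printing Implicit Defensive.

Import Order.TTheory GRing.Theory Num.Theory.

Record sgraph := SGraph {
  svertex :> finType;
  sedge : rel svertex;
  sedge_sym : symmetric sedge;
  sedge_irrefl : irreflexive sedge }.

Definition connected_graph (G : sgraph) : Prop :=
  forall x y : G, connect (@sedge G) x y.

Definition neighbors (G : sgraph) (x : G) : {set G} :=
  [set y | sedge x y]%SET.

Definition degree (G : sgraph) (x : G) : nat := #|neighbors x|.

Definition edge_set (G : sgraph) : {set {set G}} :=
  [set [set p.1; p.2]%SET | p : G * G & sedge p.1 p.2]%SET.

Section Subdivision.
Variables (q : nat) (G : sgraph).

(* (A, k) is the middle node of the k-th of the q paths replacing the edge A. *)
Definition new_node : finType := ({A : {set G} | A \in edge_set G} * 'I_q)%type.

Definition subdiv_rel : rel (G + new_node)%type := fun x y =>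
  match x, y with
  | inl u, inr i | inr i, inl u => u \in val i.1
  | _, _ => false
  end.

Lemma subdiv_rel_sym : symmetric subdiv_rel.
Proof. by case=> [u|i] [v|j]. Qed.

Lemma subdiv_rel_irrefl : irreflexive subdiv_rel.
Proof. by case. Qed.

Definition subdivision : sgraph := SGraph subdiv_rel_sym subdiv_rel_irrefl.

Definition old_vertex : G -> subdivision := inl.
Definition new_vertex : new_node -> subdivision := inr.

End Subdivision.

Arguments old_vertex q {G} _.
Arguments new_vertex {q G} _.

Section HittingTime.
Variables (R : realType) (G : sgraph).
Local Open Scope ring_scope.

Definition step_prob (x y : G) : R :=
  if sedge x y then (degree x)%:R^-1 else 0.

(* Probability that the walk started at x makes the successive moves w. *)
Fixpoint path_prob (x : G) (w : seq G) : R :=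
  if w is y :: w' then step_prob x y * path_prob y w' else 1.

(* Probability that the walk started at i first reaches j at time k: in the
   trajectory i :: w, the last node is j and no earlier one is. *)
Definition first_hit_prob (i j : G) (k : nat) : R :=
  \sum_(w : k.-tuple G | (last i w == j) && (j \notin belast i w))
    path_prob i w.

(* The expectation of the first time at j, a variable with values in
   nat U {+oo}; the second summand is the contribution of the event that j is
   never reached (+oo * 0 = 0). *)
Definition hitting_time (i j : G) : \bar R :=
  (\sum_(0 <= k <oo) (k%:R * first_hit_prob i j k)%:E
   + +oo * (1 - \sum_(0 <= k <oo) (first_hit_prob i j k)%:E))%E.

End HittingTime.

Arguments hitting_time R {G} i j.

(* Main.v *)
Require Import Defs.
From HB Require Import structures.
From mathcomp Require Import all_boot all_order all_algebra.
From mathcomp Require Import boolp classical_sets reals ereal topology.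
From mathcomp Require Import normedtype sequences.
From mathcomp Require Import ring lra.

Set Implicit Arguments.
Unset Strict Implicit.
Unset Printing Implicit Defensive.

Import Order.TTheory GRing.Theory Num.Theory.
Import numFieldNormedType.Exports.

(** In a connected graph the expected time T i j to reach j from i solves a
Poisson system: T j j = 0 and, for i other than j, the Laplacian equation
deg(i) T i j = deg(i) + (sum of T y j over the neighbors y of i).  Conversely
any real solution of that system is the hitting time.  The formulas for the
q-subdivision are therefore established by exhibiting a function on its nodes,
built from the hitting times of G, and checking that it solves the system of
S_q(G) for the target at hand.

The converse ([hitting_time_poisson]) is the analytic part, since a hitting
time is defined as an extended-real series over trajectories.  Let Q be the
transition operator killed at j.  The probability of not having met j up to
time n is Q^n applied to the indicator of the nodes other than j, so
first-hit probabilities are its successive differences, and both series have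
explicit partial sums.  Unrolling the Poisson equation n times writes a
solution f as the truncated expectation plus the remainder Q^n f.  A solution
is nonnegative by the minimum principle, and f - 1 = Q f away from j with f
bounded forces Q f <= r f for some r < 1: the solution is its own Lyapunov
function.  All remainders thus decay geometrically.

Real solutions exist on a connected graph ([poisson_exists]) because the
Laplacian with one row replaced by evaluation at j is injective, by the maximum
principle.  Summing the Laplacian of T(., j) over all nodes gives 0, which
yields the missing equation at i = j: it amounts to the expected return time
2m / deg(j) ([hitting_time_system]).

For an old target j the solution is 4 T u j at an old node u, and
1 + 2 (T s j + T t j) at a new node in the middle of st.  For a new target in
the middle of uv, write g(x) = T x u + T x v and K = g(u) + g(v).  The solution
is 2mq - 1 + 2 g(x) - K at an old node x and 2mq - K + g(s) + g(t) at a new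
node in the middle of st.  At the target itself the latter expression is 2mq
instead of 0; the defect 2mq is seen exactly by the old nodes u and v, where
it cancels the return-time term in the equation for g
([hitting_time_to_old], [hitting_time_to_new]). *)

Local Open Scope ring_scope.

(** * First-hit and survival probabilities *)

(** Conditioning on the first move of a trajectory. *)
Lemma big_tuple_cons (R : nmodType) (T : finType) k (P : pred (seq T))
    (F : seq T -> R) :
  \sum_(w : k.+1.-tuple T | P w) F w
  = \sum_y \sum_(w : k.-tuple T | P (y :: w)) F (y :: w).
Proof.
rewrite pair_big_dep /=.
rewrite (reindex (fun p : T * k.-tuple T => [tuple of p.1 :: p.2])) //=.
exists (fun t : k.+1.-tuple T => (thead t, [tuple of behead t])).
  by case=> y w _; congr pair; apply: val_inj.
by move=> t _; rewrite [RHS](tuple_eta t).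
Qed.

Section KilledWalk.
Variables (R : realType) (G : sgraph) (j : G).
Implicit Types (f g : G -> R) (i x y : G) (k n : nat).

(** The transition operator of the walk killed on arrival at [j]. *)
Definition killed_step f i : R :=
  if i == j then 0 else (degree i)%:R^-1 * \sum_(y in neighbors i) f y.

(** The probability that the walk has not visited [j] at times 0, ..., n. *)
Definition survival n : G -> R :=
  iter n killed_step (fun i => (i != j)%:R).

Lemma killed_stepB f g i :
  killed_step (fun x => f x - g x) i = killed_step f i - killed_step g i.
Proof.
by rewrite /killed_step; case: ifP => _; rewrite ?subrr // -mulrBr sumrB.
Qed.

Lemma killed_stepZ c f i :
  killed_step (fun x => c * f x) i = c * killed_step f i.
Proof.
by rewrite /killed_step; case: ifP => _; rewrite ?mulr0 // -mulr_sumr mulrCA.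
Qed.

Lemma killed_step_le f g :
  (forall x, f x <= g x) -> forall i, killed_step f i <= killed_step g i.
Proof.
move=> le_fg i; rewrite /killed_step; case: ifP => // _.
by rewrite ler_wpM2l ?invr_ge0 ?ler0n // ler_sum.
Qed.

Lemma iter_killed_stepB n f g i :
  iter n killed_step (fun x => f x - g x) i
  = iter n killed_step f i - iter n killed_step g i.
Proof.
elim: n i => [//|n IHn] i; rewrite !iterS -killed_stepB.
by congr (killed_step _ i); apply/funext.
Qed.

Lemma iter_killed_stepZ n c f i :
  iter n killed_step (fun x => c * f x) i = c * iter n killed_step f i.
Proof.
elim: n i => [//|n IHn] i; rewrite !iterS -killed_stepZ.
by congr (killed_step _ i); apply/funext.
Qed.

Lemma iter_killed_step_le n f g :
  (forall x, f x <= g x) ->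
  forall i, iter n killed_step f i <= iter n killed_step g i.
Proof. by move=> le_fg; elim: n => [//|n IHn] i; apply: killed_step_le. Qed.

Lemma first_hit_prob0 i : first_hit_prob R i j 0 = 1 - (i != j)%:R.
Proof.
rewrite /first_hit_prob (eq_bigl (fun=> i == j)); last first.
  by move=> w; rewrite (tuple0 w) /= andbT.
case: eqP => _ /=; last by rewrite big_pred0_eq subrr.
rewrite (big_pred1 [tuple]) ?subr0 // => w.
by rewrite (tuple0 w) /= eqxx.
Qed.

Lemma first_hit_probS i k :
  first_hit_prob R i j k.+1 = killed_step (fun x => first_hit_prob R x j k) i.
Proof.
rewrite /first_hit_prob (@big_tuple_cons R G k
  (fun w => (last i w == j) && (j \notin belast i w)) (path_prob R i)) /=.
rewrite /killed_step (eq_sym i j); case: eqVneq => [<-|neq_ji].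
  by apply: big1 => y _; apply: big_pred0 => w; rewrite inE eqxx andbF.
rewrite mulr_sumr [RHS]big_mkcond; apply: eq_bigr => y _ /=.
rewrite !inE -mulr_sumr /step_prob.
under [in LHS]eq_bigl do rewrite inE negb_or neq_ji.
by case: ifP; rewrite ?mul0r.
Qed.

Hypothesis deg_gt0 : forall x, (0 < degree x)%N.

Lemma degree_neq0 x : (degree x)%:R != 0 :> R.
Proof. by rewrite pnatr_eq0 -lt0n. Qed.

Lemma killed_step1 : killed_step (fun=> 1) = survival 0.
Proof.
apply/funext => i; rewrite /killed_step /survival /=; case: eqP => // _.
by rewrite sumr_const mulVf ?degree_neq0.
Qed.

(** Reaching [j] at time 0 has probability one minus the survival at time 0, and
one killed step maps the constant 1 to that same survival function; iterating
the killed step turns this into a difference of consecutive survivals. *)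
Lemma first_hit_prob_survival i k :
  first_hit_prob R i j k.+1 = survival k i - survival k.+1 i.
Proof.
have first_hit_iter n : (fun x => first_hit_prob R x j n)
    = iter n killed_step (fun x => 1 - survival 0 x).
  elim: n => [|n IHn]; apply/funext => x; first exact: first_hit_prob0.
  by rewrite first_hit_probS IHn.
rewrite (congr1 (@^~ i) (first_hit_iter k.+1)) iter_killed_stepB iterSr.
by rewrite killed_step1.
Qed.

Lemma sum_first_hit_prob n i :
  \sum_(0 <= k < n.+1) first_hit_prob R i j k = 1 - survival n i.
Proof.
elim: n => [|n IHn]; first by rewrite big_nat1 first_hit_prob0.
by rewrite big_nat_recr //= IHn first_hit_prob_survival addrA subrK.
Qed.

(** Summation by parts: the truncated expectation is a sum of tail probabilities
with a boundary term. *)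
Lemma sum_time_first_hit_prob n i :
  \sum_(0 <= k < n.+1) k%:R * first_hit_prob R i j k
  = \sum_(0 <= k < n) survival k i - n%:R * survival n i.
Proof.
elim: n => [|n IHn]; first by rewrite big_nat1 big_nil !mul0r subrr.
rewrite big_nat_recr //= IHn first_hit_prob_survival big_nat_recr //= -natr1.
ring.
Qed.

Lemma survival_ge0 n i : 0 <= survival n i.
Proof.
rewrite -[0](mul0r (survival n i)) -iter_killed_stepZ.
by apply: iter_killed_step_le => x; rewrite mul0r ler0n.
Qed.

(** The system satisfied by the expected hitting times of [j], multiplied by the
degrees so that no division occurs. *)
Variable f : G -> R.
Hypothesis fj0 : f j = 0.
Hypothesis f_poisson : forall i, i != j ->
  (degree i)%:R * f i = (degree i)%:R + \sum_(y in neighbors i) f y.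

(** Minimum principle: at a minimum other than [j] the value would be at least
one plus itself. *)
Lemma poisson_ge0 i : 0 <= f i.
Proof.
have [x _ fx_min] := arg_minP f (erefl (xpredT j)).
apply: le_trans (fx_min i _) => //.
have [->|neq_xj] := eqVneq x j; first by rewrite fj0.
have : (degree x)%:R + \sum_(y in neighbors x) f x
    <= (degree x)%:R + \sum_(y in neighbors x) f y.
  by rewrite lerD2l ler_sum // => y _; apply: fx_min.
rewrite -f_poisson // sumr_const -[f x *+ _]mulr_natl.
have : 0 < (degree x)%:R :> R by rewrite ltr0n.
rewrite /degree; lra.
Qed.

Lemma poissonE i : f i = survival 0 i + killed_step f i.
Proof.
rewrite /survival /killed_step /=; case: (eqVneq i j) => [->|neq_ij].
  by rewrite fj0 addr0.
apply: (mulfI (degree_neq0 i)); rewrite f_poisson // mulrDr mulr1.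
by rewrite mulVKf ?degree_neq0.
Qed.

Lemma iter_poisson n i :
  iter n killed_step f i = survival n i + iter n.+1 killed_step f i.
Proof.
apply/eqP; rewrite -subr_eq iterSr -iter_killed_stepB; apply/eqP.
by congr (iter n _ _ i); apply/funext => x; rewrite [f x]poissonE addrK.
Qed.

(** The Poisson equation unrolled along the first [n] steps: [f] is the truncated
sum of survivals plus a remainder that has to be shown to vanish. *)
Lemma poisson_partial_sum n i :
  f i = \sum_(0 <= k < n) survival k i + iter n killed_step f i.
Proof.
elim: n => [|n IHn]; first by rewrite big_nil add0r.
by rewrite IHn big_nat_recr //= -addrA [iter n _ _ _]iter_poisson.
Qed.

(** The solution is a Lyapunov function for the killed walk.  If C >= 1 bounds
[f], then the n-th remainder is at most C times the n-th survival, while a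
further step decreases it by exactly that survival; so each step shrinks it by
the factor 1 - 1/C. *)
Lemma poisson_geometric : exists2 r : R, 0 <= r < 1 &
  forall n i, iter n killed_step f i <= f i * r ^+ n.
Proof.
pose C := 1 + \sum_x f x.
have C_ge1 : 1 <= C by rewrite lerDl sumr_ge0 // => x _; apply: poisson_ge0.
have C_gt0 : 0 < C by apply: lt_le_trans C_ge1.
exists (1 - C^-1).
  by rewrite subr_ge0 invf_le1 // C_ge1 ltrBlDr ltrDl invr_gt0.
move=> n i; elim: n => [|n IHn]; first by rewrite mulr1.
have le_C : iter n killed_step f i <= C * survival n i.
  rewrite /survival -iter_killed_stepZ; apply: iter_killed_step_le => x.
  case: (eqVneq x j) => [->|_]; first by rewrite fj0 mulr0.
  rewrite mulr1 /C (bigD1 x) //= addrCA lerDl addr_ge0 //.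
  by rewrite sumr_ge0 // => y _; apply: poisson_ge0.
rewrite exprSr mulrA.
apply: (@le_trans _ _ (iter n killed_step f i * (1 - C^-1))); last first.
  by rewrite ler_wpM2r // subr_ge0 invf_le1.
rewrite mulrBr mulr1 lerBrDr [leRHS]iter_poisson addrC lerD2r.
by rewrite -ler_pdivlMr ?invr_gt0 // invrK mulrC.
Qed.

Lemma survival_le_poisson n i : survival n i <= iter n killed_step f i.
Proof.
apply: iter_killed_step_le => x; rewrite [leRHS]poissonE lerDl.
rewrite -[0](mul0r (killed_step f x)) -killed_stepZ.
by apply: killed_step_le => y; rewrite mul0r poisson_ge0.
Qed.

End KilledWalk.

(** * Solutions of the Poisson system are hitting times *)

Section HittingTimePoisson.
Variables (R : realType).
Local Open Scope classical_set_scope.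

Lemma cvg_nat_mul_geometric (r : R) : 0 <= r < 1 ->
  (fun n => n%:R * r ^+ n) @ \oo --> (0 : R).
Proof.
move=> /andP[r_ge0 r_lt1]; pose s := Num.sqrt r.
(* With s the square root of r, the factor n s^n is bounded and s^n remains. *)
have s_ge0 : 0 <= s by apply: sqrtr_ge0.
have sE : s ^+ 2 = r by apply: sqr_sqrtr.
have s_lt1 : s < 1 by rewrite -(@expr_lt1 _ 2) ?sE.
(* n s^n is at most 1 + s + ... + s^(n-1), which is at most 1 / (1 - s). *)
have ns_le n : n%:R * s ^+ n <= (1 - s)^-1.
  rewrite -[leRHS]mul1r ler_pdivlMr ?subr_gt0 //.
  apply: (@le_trans _ _ ((1 - s) * \sum_(k < n) s ^+ k)).
    rewrite mulrC ler_wpM2l ?subr_ge0 ?(ltW s_lt1) // -{1}[n]card_ord.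
    rewrite mulr_natl -sumr_const ler_sum // => k _.
    by rewrite ler_wiXn2l ?(ltW s_lt1) // ltnW.
  by rewrite -opprB mulNr -subrX1 opprB lerBlDr lerDl exprn_ge0.
apply: (@squeeze_cvgr _ _ _ _ (fun=> 0) (geometric (1 - s)^-1 s)).
- near=> n; rewrite mulr_ge0 ?exprn_ge0 //=.
  by rewrite -sE exprAC expr2 mulrA ler_wpM2r ?exprn_ge0.
- exact: cvg_cst.
- by apply: cvg_geometric; rewrite ger0_norm.
Unshelve. all: by end_near. Qed.

Lemma eseries_EFin (u : nat -> R) (l : R) :
  (fun n => \sum_(0 <= k < n.+1) u k) @ \oo --> l ->
  (\sum_(0 <= k <oo) (u k)%:E)%E = l%:E.
Proof.
move=> ul; apply: cvg_lim => //; rewrite -cvg_shiftS /=.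
under eq_fun do rewrite sumEFin.
by apply: cvg_EFin => //; near=> n.
Unshelve. all: by end_near. Qed.

Variables (G : sgraph) (j : G) (f : G -> R).
Hypothesis deg_gt0 : forall x : G, (0 < degree x)%N.
Hypothesis fj0 : f j = 0.
Hypothesis f_poisson : forall i, i != j ->
  (degree i)%:R * f i = (degree i)%:R + \sum_(y in neighbors i) f y.

(** The remainder of the unrolled equation and the boundary term of the summation
by parts both vanish, so the truncated expectations tend to [f i].  The walk
reaches [j] almost surely, hence the infinite time has weight 0 in the
definition of the hitting time. *)
Lemma hitting_time_poisson i : hitting_time R i j = (f i)%:E.
Proof.
have [r r01 V_le] := poisson_geometric deg_gt0 fj0 f_poisson.
have S_le n := survival_le_poisson deg_gt0 fj0 f_poisson n.
have V_ge0 n : 0 <= iter n (killed_step j) f i.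
  by apply: le_trans (S_le n i); apply: survival_ge0.
have geom_cvg0 : (fun n => f i * r ^+ n) @ \oo --> (0 : R).
  by apply: cvg_geometric; case/andP: r01 => r0 r1; rewrite ger0_norm.
have V_cvg0 : (fun n => iter n (killed_step j) f i) @ \oo --> (0 : R).
  apply: squeeze_cvgr (cvg_cst 0) geom_cvg0.
  by near=> n; rewrite V_ge0 V_le.
have S_cvg0 : (fun n => survival R j n i) @ \oo --> (0 : R).
  apply: squeeze_cvgr (cvg_cst 0) V_cvg0.
  by near=> n; rewrite survival_ge0 S_le.
have nS_cvg0 : (fun n => n%:R * survival R j n i) @ \oo --> (0 : R).
  apply: (@squeeze_cvgr _ _ _ _ (fun=> 0) (fun n => f i * (n%:R * r ^+ n))).
  - near=> n; rewrite mulr_ge0 ?survival_ge0 //= mulrCA ler_wpM2l //.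
    by apply: le_trans (S_le n i) (V_le n i).
  - exact: cvg_cst.
  - rewrite -[X in _ --> X](mulr0 (f i)).
    by apply: cvgM; [exact: cvg_cst|exact: cvg_nat_mul_geometric].
have time_cvg : (fun n => \sum_(0 <= k < n.+1)
    k%:R * first_hit_prob R i j k) @ \oo --> f i.
  have sumE n : \sum_(0 <= k < n.+1) k%:R * first_hit_prob R i j k
      = f i - iter n (killed_step j) f i - n%:R * survival R j n i.
    rewrite sum_time_first_hit_prob //.
    by rewrite {1}(poisson_partial_sum deg_gt0 fj0 f_poisson n i) addrK.
  have := cvgB (cvgB (cvg_cst (f i)) V_cvg0) nS_cvg0.
  by rewrite (funext sumE) !subr0; apply.
have prob_cvg : (fun n => \sum_(0 <= k < n.+1)
    first_hit_prob R i j k) @ \oo --> (1 : R).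
  have := cvgB (cvg_cst (1 : R)) S_cvg0.
  by rewrite (funext (fun n => sum_first_hit_prob R j deg_gt0 n i)) subr0; apply.
rewrite /hitting_time (eseries_EFin time_cvg) (eseries_EFin prob_cvg).
by rewrite subee // mule0 adde0.
Unshelve. all: by end_near. Qed.

End HittingTimePoisson.

(** * Existence of a solution on a connected graph *)

Section Existence.
Variables (R : realType) (G : sgraph).
Hypothesis conn : connected_graph G.

(** Maximum principle: where [g] is maximal, all neighbors share its value, and
the maximum propagates along a path to [j], where [g] vanishes. *)
Lemma harmonic_le0 (j : G) (g : G -> R) : g j = 0 ->
  (forall i, i != j ->
     (degree i)%:R * g i = \sum_(y in neighbors i) g y) ->
  forall i, g i <= 0.
Proof.
move=> gj0 g_harm i.
have [x _ gx_max] := arg_maxP g (erefl (xpredT j)).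
suff <- : g x = 0 by apply: gx_max.
have /connectP[p xp jE] := conn x j.
elim: p x xp jE gx_max => [|y p IHp] x /=; first by move=> _ <-.
move=> /andP[xy yp] jE gx_max.
have [->|neq_xj] := eqVneq x j; first exact: gj0.
suff gxy : g x = g y by rewrite gxy; apply: IHp yp jE _; rewrite -gxy.
have sum0 : \sum_(z in neighbors x) (g x - g z) = 0.
  by rewrite sumrB sumr_const -[g x *+ _]mulr_natl -g_harm // subrr.
apply/eqP; rewrite -subr_eq0; apply/eqP.
apply: (psumr_eq0P _ sum0); last by rewrite inE.
by move=> z _; rewrite subr_ge0 gx_max.
Qed.

(** A square linear system with trivial kernel is solvable; a kernel element and
its opposite are both nonpositive by [harmonic_le0]. *)
Lemma poisson_exists (j : G) : exists2 f : G -> R, f j = 0 &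
  forall i, i != j ->
    (degree i)%:R * f i = (degree i)%:R + \sum_(y in neighbors i) f y.
Proof.
pose L (f : {ffun G -> R^o}) : {ffun G -> R^o} := [ffun i =>
  if i == j then f j else (degree i)%:R * f i - \sum_(y in neighbors i) f y].
have Llin : linear L.
  move=> c f g; apply/ffunP => i; rewrite !ffunE; case: ifP => // _.
  under eq_bigr do rewrite !ffunE.
  by rewrite big_split /= -scaler_sumr /GRing.scale /=; ring.
pose LL : {linear {ffun G -> R^o} -> {ffun G -> R^o}} :=
  HB.pack L (GRing.isLinear.Build _ _ _ _ L Llin).
have ker_le0 f : L f = 0 -> forall i, f i <= 0.
  move=> Lf0; have Lf i : L f i = 0 by rewrite Lf0 ffunE.
  apply: (@harmonic_le0 j); first by have := Lf j; rewrite ffunE eqxx.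
  move=> i /negPf neq_ij; have := Lf i; rewrite ffunE neq_ij => /eqP.
  by rewrite subr_eq0 => /eqP.
have ker0 : lker (linfun LL) == 0%VS.
  rewrite -subv0; apply/subvP => f; rewrite memv_ker lfunE /= memv0 => /eqP Lf0.
  apply/eqP/ffunP => i; apply/eqP; rewrite ffunE eq_le ker_le0 //=.
  have := ker_le0 (- f) _ i; rewrite ffunE oppr_le0; apply.
  by rewrite -[L _]/(LL (- f)) linearN /= [L f]Lf0 oppr0.
pose b : {ffun G -> R^o} := [ffun i => if i == j then 0 else (degree i)%:R].
pose f := (linfun LL)^-1%VF b.
have LfE i : L f i = b i.
  by rewrite -[L f]/(LL f) -(lfunE LL) /f lker0_lfunVK.
have fj0 : f j = 0 by have := LfE j; rewrite !ffunE eqxx.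
exists f => // i /negPf neq_ij; have := LfE i; rewrite !ffunE neq_ij => /eqP.
by rewrite subr_eq => /eqP.
Qed.

End Existence.

(** * Edges as two-element sets *)

Section Edges.
Variable G : sgraph.

Lemma sedge_neq (s t : G) : sedge s t -> s != t.
Proof. by move=> st; apply: contraTneq st => ->; rewrite sedge_irrefl. Qed.

Lemma edge_setP (A : {set G}) :
  reflect (exists s t : G, sedge s t /\ A = [set s; t]%SET) (A \in edge_set G).
Proof.
apply: (iffP imsetP) => [[[s t] /=] | [s [t [st ->]]]].
  by rewrite inE /= => st ->; exists s, t.
by exists (s, t) => //; rewrite inE.
Qed.

Lemma card_edge (A : {set G}) : A \in edge_set G -> #|A| = 2%N.
Proof. by move=> /edge_setP[s [t [/sedge_neq st ->]]]; rewrite cards2 st. Qed.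

Lemma sum_edge (V : nmodType) (h : G -> V) (s t : G) :
  [set s; t]%SET \in edge_set G ->
  \sum_(x in [set s; t]%SET) h x = h s + h t.
Proof.
move=> /card_edge; rewrite cards2; case: (eqVneq s t) => // neq_st _.
by rewrite big_setU1 ?inE // big_set1.
Qed.

(** Mapping a neighbor [v] to the edge [[set u; v]] is a bijection onto the edges
through [u]. *)
Lemma sum_incident_edges (V : nmodType) (Phi : {set G} -> V) (u : G) :
  \sum_(A in edge_set G | u \in A) Phi A
  = \sum_(v in neighbors u) Phi [set u; v]%SET.
Proof.
rewrite -(@big_imset _ _ _ _ _ (fun v => [set u; v]%SET) _ Phi) /=; last first.
  move=> v w; rewrite !inE => /sedge_neq uv /sedge_neq uw /setP eq_uvw.
  have := eq_uvw v; rewrite !inE eqxx orbT eq_sym (negPf uv) /=.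
  by move=> /esym/eqP.
apply: eq_bigl => A; apply/andP/imsetP => [[/edge_setP[s [t [st ->]]]]|].
  rewrite !inE => /orP[]/eqP ->; first by exists t; rewrite ?inE.
  by exists s; rewrite ?inE 1?sedge_sym // finset.setUC.
case=> v; rewrite inE => uv ->; split; last by rewrite !inE eqxx.
by apply/edge_setP; exists u, v.
Qed.

Lemma neighbors_sym (x y : G) : (x \in neighbors y) = (y \in neighbors x).
Proof. by rewrite !inE sedge_sym. Qed.

(** Count the incident pairs of a node and an edge from both sides. *)
Lemma sum_degree : (\sum_(u : G) degree u)%N = (2 * #|edge_set G|)%N.
Proof.
under eq_bigr => u _ do rewrite /degree -sum1_card.
under eq_bigr => u _ do rewrite -(sum_incident_edges (fun=> 1%N)).
rewrite (exchange_big_dep (fun A : {set G} => A \in edge_set G)) /=; last first.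
  by move=> u A _ /andP[].
rewrite mulnC -sum_nat_const; apply: eq_bigr => A A_edge.
by rewrite -(card_edge A_edge) -sum1_card; apply: eq_bigl => u; rewrite A_edge.
Qed.

Lemma degree_gt0 : connected_graph G -> (2 <= #|G|)%N ->
  forall x : G, (0 < degree x)%N.
Proof.
move=> conn card_G x.
have [y neq_yx] : exists y, y != x.
  apply/existsP; rewrite -negb_forall; apply: contraL card_G => /forallP all_x.
  rewrite -ltnNge ltnS; apply/card_le1_eqP => y z _ _.
  by rewrite (eqP (all_x y)) (eqP (all_x z)).
have /connectP[[|z p] /=] := conn x y.
  by move=> _ yx; rewrite yx eqxx in neq_yx.
by move=> /andP[xz _] _; apply/card_gt0P; exists z; rewrite inE.
Qed.

End Edges.

(** * Neighborhoods in the subdivision *)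

Section SubdivisionNeighbors.
Variables (q : nat) (G : sgraph) (V : nmodType).
Implicit Types (i : new_node q G) (F : subdivision q G -> V).

Lemma sum_neighbors_new F i :
  \sum_(y in neighbors (new_vertex i)) F y
  = \sum_(x in val i.1) F (old_vertex q x).
Proof.
rewrite big_sumType /= [X in _ + X]big_pred0 ?addr0; last first.
  by move=> k; rewrite inE.
by apply: eq_bigl => x; rewrite inE.
Qed.

(** The new nodes next to [u] are the [q] copies of the edges through [u]; when a
function does not distinguish the copies, the sum is [q] times a sum over the
neighbors of [u] in the original graph. *)
Lemma sum_neighbors_old F (Phi : {set G} -> V) u :
  (forall i, F (new_vertex i) = Phi (val i.1)) ->
  \sum_(y in neighbors (old_vertex q u)) F y
  = (\sum_(v in neighbors u) Phi [set u; v]%SET) *+ q.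
Proof.
move=> F_new; rewrite big_sumType /= big_pred0 ?add0r; last first.
  by move=> x; rewrite inE.
transitivity (\sum_(e : {A | A \in edge_set G} | u \in val e)
    \sum_(k < q) Phi (val e)).
  rewrite pair_big; apply: eq_big => [e|e _]; first by rewrite inE /= andbT.
  exact: F_new.
under [in LHS]eq_bigr do rewrite sumr_const card_ord.
rewrite sumrMnl -sum_incident_edges; congr (_ *+ _).
rewrite [RHS](reindex_omap (val : {A | A \in edge_set G} -> {set G}) insub) /=; last first.
  by move=> A /andP[A_edge _]; rewrite insubT.
apply: eq_bigl => e; rewrite (valP e) /=.
by case: insubP => [e' _ /val_inj ->|]; rewrite ?eqxx ?andbT // (valP e).
Qed.

End SubdivisionNeighbors.

Section SubdivisionDegrees.
Variables (q : nat) (G : sgraph).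

Lemma degree_new (i : new_node q G) : degree (new_vertex i) = 2%N.
Proof.
rewrite /degree -sum1_card (sum_neighbors_new (fun=> 1%N)) sum1_card.
exact: card_edge (valP i.1).
Qed.

Lemma degree_old (u : G) : degree (old_vertex q u) = (q * degree u)%N.
Proof.
rewrite /degree -sum1_card (@sum_neighbors_old _ _ _ (fun=> 1%N) (fun=> 1%N)) //.
by rewrite sum1_card -mulr_natr mulnC natn.
Qed.

Lemma neighbors_newE (i : new_node q G) (s t : G) :
  neighbors (new_vertex i) = [set old_vertex q s; old_vertex q t]%SET ->
  val i.1 = [set s; t]%SET.
Proof.
move=> /setP eq_st; apply/setP => x.
by have := eq_st (old_vertex q x); rewrite !inE.
Qed.

End SubdivisionDegrees.

(** * The full linear system of the hitting times *)

Lemma sum_indicator (R : pzSemiRingType) (I : finType) (P : pred I) (a : I)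
    (c : R) :
  \sum_(x | P x) (x == a)%:R * c = (P a)%:R * c.
Proof.
case: (boolP (P a)) => [Pa|nPa].
  rewrite (bigD1 a) //= eqxx big1 ?addr0 // => x /andP[_ /negPf ->].
  by rewrite mul0r.
by rewrite mul0r big1 // => x; case: eqP nPa => [-> /negPf ->|] //; rewrite mul0r.
Qed.

Section HittingTimeSystem.
Variables (R : realType) (G : sgraph).
Hypothesis conn : connected_graph G.
Hypothesis deg_gt0 : forall x : G, (0 < degree x)%N.

(** The Laplacian is symmetric and kills constants. *)
Lemma sum_laplacian (f : G -> R) :
  \sum_i ((degree i)%:R * f i - \sum_(y in neighbors i) f y) = 0.
Proof.
rewrite sumrB [X in _ - X](exchange_big_dep xpredT) //=.
apply/eqP; rewrite subr_eq0; apply/eqP; apply: eq_bigr => y _.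
under [RHS]eq_bigl do rewrite neighbors_sym.
by rewrite sumr_const -[RHS]mulr_natl.
Qed.

(** The last clause also covers [i = j], with the extra term 2m.  It follows from
[sum_laplacian]: the Laplacian of the hitting times to [j] is [degree i] at
every other node [i], so at [j] it is minus the sum of these degrees, that is
[degree j] - 2m. *)
Lemma hitting_time_system : exists T : G -> G -> R,
  [/\ forall i j, hitting_time R i j = (T i j)%:E,
      forall j, T j j = 0
    & forall i j, \sum_(y in neighbors i) T y j
        = (degree i)%:R * (T i j - 1) + (i == j)%:R * (2 * #|edge_set G|)%:R].
Proof.
have T_poisson (j : G) := cid2 (poisson_exists R conn j).
exists (fun i j => s2val (T_poisson j) i).
split=> [i j|j|i j]; case: (T_poisson j) => f /= fj0 f_eq //.
  exact: hitting_time_poisson.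
have [->|neq_ij] := eqVneq i j; last first.
  by rewrite mul0r addr0 mulrBr mulr1 f_eq // addrAC subrr add0r.
rewrite fj0 mul1r natrM; have := sum_laplacian f; rewrite (bigD1 j) //= fj0.
rewrite [X in _ + X](eq_bigr (fun i => (degree i)%:R)); last first.
  by move=> x neq_xj; rewrite f_eq // addrK.
have : \sum_(x : G) (degree x)%:R = 2 * #|edge_set G|%:R :> R.
  by rewrite -natr_sum sum_degree natrM.
rewrite (bigD1 j) //=; lra.
Qed.

End HittingTimeSystem.

(** * Explicit solutions on the subdivision *)

Section Subdivided.
Variables (R : realType) (q : nat) (G : sgraph) (T : G -> G -> R).
Local Notation m := #|edge_set G|.
Hypothesis q_gt0 : (0 < q)%N.
Hypothesis deg_gt0 : forall x : G, (0 < degree x)%N.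
Hypothesis T_refl : forall j, T j j = 0.
Hypothesis T_sum : forall i j, \sum_(y in neighbors i) T y j
  = (degree i)%:R * (T i j - 1) + (i == j)%:R * (2 * m)%:R.

Lemma subdivision_degree_gt0 (x : subdivision q G) : (0 < degree x)%N.
Proof.
case: x => [u|i]; first by rewrite [degree _]degree_old muln_gt0 q_gt0 deg_gt0.
by rewrite [degree _]degree_new.
Qed.

Lemma sum_edge_shift (i : new_node q G) c (h : G -> R) :
  \sum_(x in val i.1) (c + h x) = 2 * c + \sum_(x in val i.1) h x.
Proof.
by rewrite big_split /= sumr_const (card_edge (valP i.1)) mulr_natl.
Qed.

Lemma sum_incident_shift (u : G) c (h : G -> R) :
  \sum_(v in neighbors u) (c + \sum_(x in [set u; v]%SET) h x)
  = (degree u)%:R * (c + h u) + \sum_(v in neighbors u) h v.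
Proof.
rewrite (eq_bigr (fun v => (c + h u) + h v)); last first.
  move=> v; rewrite inE => uv; rewrite sum_edge ?addrA //.
  by apply/edge_setP; exists u, v.
by rewrite big_split /= sumr_const mulr_natl.
Qed.

Definition time_to_old (j : G) (x : subdivision q G) : R :=
  match x with
  | inl u => 4 * T u j
  | inr i => 1 + 2 * \sum_(x in val i.1) T x j
  end.

Lemma hitting_time_to_old (j : G) x :
  hitting_time R x (old_vertex q j) = (time_to_old j x)%:E.
Proof.
apply: hitting_time_poisson; first exact: subdivision_degree_gt0.
  by rewrite /= T_refl mulr0.
move=> {}x; case: x => [u|i].
  rewrite [_ == _](_ : _ = (u == j)) // => neq_uj.
  rewrite -[inl u]/(old_vertex q u) degree_old.
  pose Phi (A : {set G}) : R := 1 + \sum_(x in A) 2 * T x j.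
  rewrite (@sum_neighbors_old _ _ _ _ Phi); last first.
    by move=> i; rewrite /= mulr_sumr.
  rewrite /Phi sum_incident_shift -mulr_sumr T_sum (negPf neq_uj).
  rewrite -mulr_natl natrM /=.
  ring.
move=> _; rewrite -[inr i]/(new_vertex i) degree_new sum_neighbors_new /=.
by rewrite -mulr_sumr; ring.
Qed.

Section ToNew.
Variable i0 : new_node q G.

Definition time_to_edge (u : G) : R := \sum_(a in val i0.1) T u a.

(** The commute time between the ends of the edge that carries [i0], as the diagonal terms
vanish. *)
Definition edge_commute : R := \sum_(x in val i0.1) time_to_edge x.

(** The general value at a new node would be 2mq at [i0]; the last summand resets
it to 0 there. *)
Definition time_to_new (x : subdivision q G) : R :=
  match x with
  | inl u => (2 * m * q)%:R - 1 + 2 * time_to_edge u - edge_commute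
  | inr i => (2 * m * q)%:R - edge_commute + \sum_(x in val i.1) time_to_edge x
             - (i == i0)%:R * (2 * m * q)%:R
  end.

(** The Laplacian equation of [time_to_edge], including the return-time term 2m at
the two ends of the edge. *)
Lemma time_to_edge_sum u :
  \sum_(v in neighbors u) time_to_edge v
  = (degree u)%:R * (time_to_edge u - 2) + (u \in val i0.1)%:R * (2 * m)%:R.
Proof.
rewrite exchange_big /=.
rewrite (eq_bigr _ (fun a _ => T_sum u a)) big_split /= -mulr_sumr sumrB.
rewrite sumr_const (card_edge (valP i0.1)); congr (_ + _).
by under eq_bigr do rewrite eq_sym; apply: sum_indicator.
Qed.

(** At an old node the [q] copies multiply the term 2m of [time_to_edge_sum] into
2mq, which compensates the value 2mq removed at [i0]. *)
Lemma hitting_time_to_new x :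
  hitting_time R x (new_vertex i0) = (time_to_new x)%:E.
Proof.
apply: hitting_time_poisson; first exact: subdivision_degree_gt0.
  by rewrite /= /edge_commute eqxx mul1r subrK subrr.
move=> {}x; case: x => [u _|i].
  rewrite -[inl u]/(old_vertex q u) degree_old.
  (* Split off the correction at i0, since the rest depends only on the edge
     that carries a new node and [sum_neighbors_old] applies to it. *)
  pose Phi (A : {set G}) : R :=
    (2 * m * q)%:R - edge_commute + \sum_(x in A) time_to_edge x.
  pose F (x : subdivision q G) : R :=
    if x is inr i then Phi (val i.1) else time_to_new x.
  pose e (x : subdivision q G) : R := (x == new_vertex i0)%:R * (2 * m * q)%:R.
  have time_F x : time_to_new x = F x - e x.
    case: x => [v|i]; rewrite /e.
      by rewrite (_ : (inl v == _) = false) // mul0r subr0.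
    by rewrite (_ : (inr i == _) = (i == i0)).
  rewrite (eq_bigr _ (fun x _ => time_F x)) sumrB.
  rewrite (@sum_neighbors_old _ _ _ _ Phi) //.
  have -> : \sum_(x in neighbors (old_vertex q u)) e x
      = (u \in val i0.1)%:R * (2 * m * q)%:R.
    rewrite /e (sum_indicator (fun x => x \in neighbors (old_vertex q u))
      (new_vertex i0 : subdivision q G)).
    by rewrite inE.
  rewrite /Phi sum_incident_shift time_to_edge_sum.
  rewrite [time_to_new _]/= !natrM.
  ring.
move=> neq_ii0; rewrite -[inr i]/(new_vertex i) degree_new sum_neighbors_new /=.
have /negPf-> : i != i0 by apply: contraNneq neq_ii0 => ->.
rewrite mul0r subr0.
under [in RHS]eq_bigr do rewrite addrAC.
rewrite sum_edge_shift -mulr_sumr; ring.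
Qed.

End ToNew.
End Subdivided.

(** * Hitting times in the subdivision *)

Local Open Scope ereal_scope.

Theorem theorem5p1 (R : realType) (q : nat) (G : sgraph)
    (hq : (1 <= q)%N) (hconn : connected_graph G) (hn : (2 <= #|G|)%N) :
  let m := #|edge_set G| in
  let T := @hitting_time R G in
  let T' := @hitting_time R (subdivision q G) in
  [/\ (forall i j : G, T' (old_vertex q i) (old_vertex q j) = 4%:R%:E * T i j),
      (forall (i : new_node q G) (j s t : G),
         neighbors (new_vertex i) = [set old_vertex q s; old_vertex q t]%SET ->
         T' (new_vertex i) (old_vertex q j) = 1 + 2%:R%:E * (T s j + T t j) /\
         T' (old_vertex q j) (new_vertex i) =
           (2 * m * q)%:R%:E - 1 + 2%:R%:E * (T j s + T j t) - (T t s + T s t))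
    & (forall (i j : new_node q G) (s t u v : G),
         i <> j ->
         neighbors (new_vertex i) = [set old_vertex q s; old_vertex q t]%SET ->
         neighbors (new_vertex j) = [set old_vertex q u; old_vertex q v]%SET ->
         T' (new_vertex i) (new_vertex j) =
           (2 * m * q)%:R%:E + T s u + T t u + T s v + T t v
           - (T u v + T v u))].
Proof.
move=> m T' S'; have deg_gt0 := degree_gt0 hconn hn.
have [T [TE T_refl T_sum]] := hitting_time_system R hconn deg_gt0.
have oldE := hitting_time_to_old hq deg_gt0 T_refl T_sum.
have newE := hitting_time_to_new hq deg_gt0 T_sum.
have edgeE (i : new_node q G) s t :
    neighbors (new_vertex i) = [set old_vertex q s; old_vertex q t]%SET ->
    forall h : G -> R, (\sum_(x in val i.1) h x)%R = (h s + h t)%R.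
  move=> /neighbors_newE i_st h; rewrite i_st; apply: sum_edge.
  by rewrite -i_st (valP i.1).
rewrite /T' /S'; split=> [i j|i j s t /edgeE i_st|i j s t u v neq_ij].
- by rewrite oldE TE -EFinM.
- rewrite oldE newE !TE /= /edge_commute /time_to_edge !i_st !T_refl.
  rewrite -!(EFinN, EFinD, EFinM).
  by split; congr EFin; ring.
move=> /edgeE i_st /edgeE j_uv.
rewrite newE !TE /= (introF eqP neq_ij) mul0r subr0.
rewrite i_st /edge_commute /time_to_edge !j_uv !T_refl.
by rewrite -!(EFinN, EFinD); congr EFin; ring.
Qed.
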